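(* Let $d$ be a soft c-derived operator on $X$. Then the family $\zeta_{d}\subseteq\mathcal{S}_{E}(X)$ defined by $\zeta_{d}=\{\Omega_{E}\in\mathcal{S}_{E}(X): d(\Omega_{E})\,\widetilde{\subseteq}\, \Omega_{E}\}$ is a soft convex structure on $X$. In addition, $\zeta_{d}=\{d(\Omega_{E})\,\widetilde{\cup}\, \Omega_{E} : \Omega_{E}\in \mathcal{S}_{E}(X)\}$.
   Context: $X$ is a nonempty set and $E$ a nonempty set of parameters. A soft set on $X$ is a pair $\Omega_E=(\Omega,E)$ with $\Omega:E\to\mathcal{P}(X)$ a function; $\mathcal{S}_E(X)$ is the family of all soft sets on $X$. $\Omega_E\,\widetilde{\subseteq}\,O_E$ means $\Omega(e)\subseteq O(e)$ for all $e\in E$. Unions $\widetilde{\cup},\widetilde{\bigcup}$ and intersections $\widetilde{\bigcap}$ of soft sets are taken parameterwise: $e\mapsto\bigcup_i\Omega_i(e)$, respectively $e\mapsto\bigcap_i\Omega_i(e)$. $\Phi_E$ is the soft set with value $\emptyset$ at every $e\in E$, and $X_E$ the soft set with value $X$ at every $e\in E$. A family $\{(\Omega_i,E):i\in I\}$ of soft sets on $X$ is soft upward directed if for each pair $i_1,i_2\in I$ there is $i_3\in I$ with $\Omega_{i_1}\,\widetilde{\subseteq}\,\Omega_{i_3}$ and $\Omega_{i_2}\,\widetilde{\subseteq}\,\Omega_{i_3}$. A family $\zeta\subseteq\mathcal{S}_E(X)$ is a soft convex structure on $X$ if: (i) $\Phi_E,X_E\in\zeta$; (ii) the intersection of each family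 of members of $\zeta$ belongs to $\zeta$; (iii) the union of each soft upward directed family of members of $\zeta$ belongs to $\zeta$. A mapping $d:\mathcal{S}_E(X)\to\mathcal{S}_E(X)$ is a soft c-derived operator (soft convexly derived operator) on $X$ if: (1) $d(\Phi_E)=\Phi_E$; (2) $\Omega_E\,\widetilde{\subseteq}\,O_E$ implies $d(\Omega_E)\,\widetilde{\subseteq}\,d(O_E)$; (3) $d(d(\Omega_E)\,\widetilde{\cup}\,\Omega_E)\,\widetilde{\subseteq}\,d(\Omega_E)\,\widetilde{\cup}\,\Omega_E$; (4) for every soft upward directed family $\{(\Omega_i,E):i\in I\}\subseteq\mathcal{S}_E(X)$, $d\left(\widetilde{\bigcup}_{i\in I}(\Omega_i,E)\right)=\widetilde{\bigcup}_{i\in I}d(\Omega_i,E)$. *)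

(* Defs.v *)
From mathcomp Require Import all_boot.
From mathcomp Require Import boolp classical_sets.

Set Implicit Arguments.
Unset Strict Implicit.
Unset Printing Implicit Defensive.

Local Open Scope classical_set_scope.

(* The ambient sets are the types [X] (universe) and [E] (parameters). As [E]
   is fixed, a soft set (Omega, E) is identified with the function Omega. *)
Definition soft_set (X E : Type) : Type := E -> set X.

Section SoftSets.
Variables X E : Type.
Implicit Types (A B : soft_set X E).

Definition soft_subset A B : Prop := forall e, A e `<=` B e.

Definition soft_null : soft_set X E := fun=> set0.

Definition soft_full : soft_set X E := fun=> setT.

Definition soft_union A B : soft_set X E := fun e => A e `|` B e.

Definition soft_bigcup (I : Type) (F : I -> soft_set X E) : soft_set X E :=
  fun e => \bigcup_i F i e.

(* The intersection of the family indexed by an empty [I] is [soft_full]. *)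
Definition soft_bigcap (I : Type) (F : I -> soft_set X E) : soft_set X E :=
  fun e => \bigcap_i F i e.

(* The family indexed by an empty [I] is vacuously directed; its union is
   [soft_null]. *)
Definition soft_up_directed (I : Type) (F : I -> soft_set X E) : Prop :=
  forall i1 i2, exists i3,
    soft_subset (F i1) (F i3) /\ soft_subset (F i2) (F i3).

Record soft_convex_structure (zeta : set (soft_set X E)) : Prop := {
  soft_convex_null : zeta soft_null;
  soft_convex_full : zeta soft_full;
  soft_convex_bigcap : forall (I : Type) (F : I -> soft_set X E),
    (forall i, zeta (F i)) -> zeta (soft_bigcap F);
  soft_convex_bigcup : forall (I : Type) (F : I -> soft_set X E),
    soft_up_directed F -> (forall i, zeta (F i)) -> zeta (soft_bigcup F)
}.

Record soft_c_derived (d : soft_set X E -> soft_set X E) : Prop := {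
  soft_c_derived_null : d soft_null = soft_null;
  soft_c_derived_mono : forall A B,
    soft_subset A B -> soft_subset (d A) (d B);
  soft_c_derived_union : forall A,
    soft_subset (d (soft_union (d A) A)) (soft_union (d A) A);
  soft_c_derived_bigcup : forall (I : Type) (F : I -> soft_set X E),
    soft_up_directed F -> d (soft_bigcup F) = soft_bigcup (fun i => d (F i))
}.

Definition soft_convex_of_derived (d : soft_set X E -> soft_set X E) :
    set (soft_set X E) :=
  [set A | soft_subset (d A) A].

End SoftSets.

(* Main.v *)
Require Import Defs.
From mathcomp Require Import all_boot.
From mathcomp Require Import boolp classical_sets.

Local Open Scope classical_set_scope.

(** The members of [soft_convex_of_derived d] are the pre-fixed points of [d].
    Pre-fixed points of a monotone operator are closed under intersection
    ([prefixed_bigcap]), and commutation of [d] with directed unions makes them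
    closed under directed unions ([prefixed_bigcup]). For the description as a
    range, [soft_c_derived_union] says that every [soft_union (d A) A] is a pre-fixed
    point; conversely a pre-fixed point [A] absorbs [d A], so it is the value of
    [soft_union (d A) A] at itself ([soft_union_absorb]). *)

Lemma soft_union_absorb (X E : Type) (A B : soft_set X E) :
  soft_subset A B -> soft_union A B = B.
Proof. by move=> AB; apply/funext => e; apply/setUidPr/AB. Qed.

(** The intersection lies below each [F i], so by monotonicity its image under
    [d] lies below every [d (F i)], hence below every [F i]. *)
Lemma prefixed_bigcap (X E : Type) (d : soft_set X E -> soft_set X E)
    (d_mono : forall A B, soft_subset A B -> soft_subset (d A) (d B))
    (I : Type) (F : I -> soft_set X E) :
  (forall i, soft_subset (d (F i)) (F i)) ->
  soft_subset (d (soft_bigcap F)) (soft_bigcap F).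
Proof.
move=> dF e x dx i _; apply: dF.
by apply: d_mono dx => e' y; apply.
Qed.

Lemma prefixed_bigcup (X E : Type) (d : soft_set X E -> soft_set X E)
    (I : Type) (F : I -> soft_set X E) :
  d (soft_bigcup F) = soft_bigcup (fun i => d (F i)) ->
  (forall i, soft_subset (d (F i)) (F i)) ->
  soft_subset (d (soft_bigcup F)) (soft_bigcup F).
Proof. by move=> -> dF e x [i _ dx]; exists i => //; apply: dF. Qed.

Theorem proposition4p1 (X E : Type)
    (X_nonempty : [set: X] !=set0) (E_nonempty : [set: E] !=set0)
    (d : soft_set X E -> soft_set X E) (d_derived : soft_c_derived d) :
  soft_convex_structure (soft_convex_of_derived d) /\
  soft_convex_of_derived d =
    [set soft_union (d A) A | A in [set: soft_set X E]].
Proof.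
case: d_derived => d_null d_mono d_union d_bigcup; split.
  split.
  - by move=> e; rewrite d_null.
  - by [].
  - by move=> I F; apply: prefixed_bigcap.
  - by move=> I F F_dir; apply: prefixed_bigcup; apply: d_bigcup.
apply/seteqP; split => [A dA | _ [A _ <-]]; last exact: d_union.
by exists A => //; apply: soft_union_absorb.
Qed.
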